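(* If $k,n\ge1$ are integers and $0<\gamma\le\frac12$, then $\pi_k^\gamma(\mathbb{H}^n)=0$.
   Context: Heisenberg group: $\mathbb{H}^n$ is $\mathbb{R}^{2n+1}$ with coordinates $(z,t)=(x_1,y_1,\dots,x_n,y_n,t)$, regarded as a metric space with the Korányi metric $$d_K\big((z,t),(z',t')\big)=\Big(|z-z'|^4+\Big|t-t'+2\sum_{j=1}^n(x_j'y_j-x_jy_j')\Big|^2\Big)^{1/4}.$$ Hölder maps: for metric spaces $X,Y$ and $0<\gamma\le 1$, $C^{0,\gamma}(X;Y)$ is the set of maps $f:X\to Y$ with $\sup_{x\ne y} d_Y(f(x),f(y))/d_X(x,y)^\gamma<\infty$. Hölder homotopy groups: for a pointed metric space $(X,x_0)$, $k\in\mathbb{N}$ and $0<\gamma\le1$, let $I^k=[0,1]^k$ and $$\pi_k^\gamma(X,x_0)=\{f\in C^{0,\gamma}(I^k;X): f\equiv x_0\text{ in a neighborhood of }\partial I^k\}/\sim,$$ where $f\sim g$ if there is $H\in C^{0,\gamma}([0,1]\times I^k;X)$ with $H(0,\cdot)=f$, $H(1,\cdot)=g$, and $H(t,\cdot)\equiv x_0$ near $\partial I^k$ for all $t$. The group structure is defined as for the usual homotopy groups. If any two points of $X$ can be joined by a Lipschitz curve (as is the case for $\mathbb{H}^n$), the group does not depend on $x_0$ up to isomorphism and is denoted $\pi_k^\gamma(X)$. *)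

(* Defs.v *)
From HB Require Import structures.
From mathcomp Require Import all_boot all_order all_algebra.
From mathcomp Require Import generic_quotient interval_inference.
From mathcomp Require Import ring lra.
From mathcomp Require Import all_classical all_reals all_analysis.

Set Implicit Arguments.
Unset Strict Implicit.
Unset Printing Implicit Defensive.

Import Order.TTheory GRing.Theory Num.Theory.
Import numFieldNormedType.Exports.

Local Open Scope classical_set_scope.
Local Open Scope ring_scope.
Local Open Scope quotient_scope.

Section Inequalities.
Variable R : realType.
Implicit Types a b c d : R.

Lemma hermitian_CS (I : finType) (a b c d : I -> R) :
  (\sum_i (a i * c i + b i * d i)) ^+ 2 + (\sum_i (a i * d i - b i * c i)) ^+ 2
  <= (\sum_i (a i ^+ 2 + b i ^+ 2)) * (\sum_i (c i ^+ 2 + d i ^+ 2)).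
Proof.
set p := \sum_i (a i * c i + b i * d i).
set q := \sum_i (a i * d i - b i * c i).
set A := \sum_i (a i ^+ 2 + b i ^+ 2).
set B := \sum_i (c i ^+ 2 + d i ^+ 2).
have B0 : 0 <= B by apply: sumr_ge0 => i _; rewrite addr_ge0 ?sqr_ge0.
have bessel : 0 <= B * (A * B - p ^+ 2 - q ^+ 2).
  have -> : B * (A * B - p ^+ 2 - q ^+ 2)
    = \sum_i ((B * a i - p * c i - q * d i) ^+ 2
              + (B * b i - p * d i + q * c i) ^+ 2).
    transitivity (B ^+ 2 * A + (p ^+ 2 + q ^+ 2) * B
                  - 2 * B * p * p - 2 * B * q * q); first by ring.
    have EA x : x * A = \sum_i x * (a i ^+ 2 + b i ^+ 2) by rewrite mulr_sumr.
    have EB x : x * B = \sum_i x * (c i ^+ 2 + d i ^+ 2) by rewrite mulr_sumr.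
    have Ep x : x * p = \sum_i x * (a i * c i + b i * d i) by rewrite mulr_sumr.
    have Eq x : x * q = \sum_i x * (a i * d i - b i * c i) by rewrite mulr_sumr.
    rewrite (EA (B ^+ 2)) (EB (p ^+ 2 + q ^+ 2)) (Ep (2 * B * p)) (Eq (2 * B * q)).
    rewrite -!sumrN -!big_split /=.
    by apply: eq_bigr => i _; ring.
  by apply: sumr_ge0 => i _; rewrite addr_ge0 ?sqr_ge0.
have [B_gt0|] := ltP 0 B.
  by move: bessel; rewrite pmulr_rge0//; lra.
move=> B_le0; have Beq0 : B = 0 by lra.
have cd0 i : c i = 0 /\ d i = 0.
  have : c i ^+ 2 + d i ^+ 2 = 0.
    apply: (psumr_eq0P _ Beq0) => // j _.
    by rewrite addr_ge0 ?sqr_ge0.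
  move/eqP; rewrite paddr_eq0 ?sqr_ge0// !sqrf_eq0.
  by case/andP => /eqP -> /eqP ->.
have -> : p = 0 by rewrite /p big1// => i _; have [-> ->] := cd0 i; ring.
have -> : q = 0 by rewrite /q big1// => i _; have [-> ->] := cd0 i; ring.
by rewrite Beq0; lra.
Qed.

Lemma sqrt_le_sqr a b : 0 <= b -> (Num.sqrt a <= b) = (a <= b ^+ 2).
Proof. by move=> b0; rewrite -{1}[b]ger0_norm// -sqrtr_sqr ler_sqrt// sqr_ge0. Qed.

Lemma minkowski_sum (I : finType) (a b : I -> R) :
  Num.sqrt (\sum_i (a i + b i) ^+ 2)
  <= Num.sqrt (\sum_i a i ^+ 2) + Num.sqrt (\sum_i b i ^+ 2).
Proof.
have sge0 (f : I -> R) : 0 <= \sum_i f i ^+ 2.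
  by apply: sumr_ge0 => i _; exact: sqr_ge0.
rewrite sqrt_le_sqr ?addr_ge0 ?sqrtr_ge0// sqrrD !sqr_sqrtr//.
have -> : \sum_i (a i + b i) ^+ 2 =
    \sum_i a i ^+ 2 + (\sum_i a i * b i) *+ 2 + \sum_i b i ^+ 2.
  rewrite -mulr_natr mulr_suml -!big_split /=.
  by apply: eq_bigr => i _; ring.
rewrite lerD2r lerD2l lerMn2r/= -sqrtrM//.
apply: le_trans (ler_norm _) _; rewrite -sqrtr_sqr ler_sqrt ?mulr_ge0//.
have := @hermitian_CS I a (fun=> 0) b (fun=> 0).
rewrite [X in _ + X ^+ 2]big1 => [|i _]; last by ring.
rewrite [X in X ^+ 2 + _](eq_bigr (fun i => a i * b i)) => [|i _]; last by ring.
rewrite [X in _ <= X * _](eq_bigr (fun i => a i ^+ 2)) => [|i _]; last by ring.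
rewrite [X in _ * X](eq_bigr (fun i => b i ^+ 2)) => [|i _]; last by ring.
by rewrite expr0n addr0.
Qed.

Lemma minkowski2 a b c d :
  Num.sqrt ((a + b) ^+ 2 + (c + d) ^+ 2)
  <= Num.sqrt (a ^+ 2 + c ^+ 2) + Num.sqrt (b ^+ 2 + d ^+ 2).
Proof.
have := @minkowski_sum bool (fun i => if i then a else c)
                            (fun i => if i then b else d).
by rewrite !big_bool.
Qed.

End Inequalities.

Section UnitInterval.
Variable R : realType.

Record unit_itv := UnitItv { uval :> R ; _ : 0 <= uval <= 1 }.

HB.instance Definition _ := [isSub for uval].
HB.instance Definition _ := [Choice of unit_itv by <:].

Lemma uvalP (u : unit_itv) : 0 <= (u : R) <= 1. Proof. by case: u. Qed.

Definition itv_dist (s t : unit_itv) : R := `|(s : R) - (t : R)|.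

Lemma itv_distxx s : itv_dist s s = 0.
Proof. by rewrite /itv_dist subrr normr0. Qed.

Lemma itv_dist_pos s t : itv_dist s t = 0 -> s = t.
Proof. by move/normr0_eq0/eqP; rewrite subr_eq0 => /eqP/val_inj. Qed.

Lemma itv_dist_sym s t : itv_dist s t = itv_dist t s.
Proof. exact: distrC. Qed.

Lemma itv_dist_triangle t s u : itv_dist s u <= itv_dist s t + itv_dist t u.
Proof. exact: ler_distD. Qed.

HB.instance Definition _ := @isMetric.Build R unit_itv itv_dist
  itv_distxx itv_dist_pos itv_dist_sym itv_dist_triangle.

Lemma clamp_subproof (r : R) : 0 <= Num.max 0 (Num.min r 1) <= 1.
Proof. by rewrite le_max lexx/= ge_max ler01/= ge_min lexx orbT. Qed.

(* The point r of [0,1] (clampE); outside [0,1] the nearest endpoint, so that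
   no membership proof has to be carried around. *)
Definition clamp (r : R) : unit_itv := UnitItv (clamp_subproof r).

Lemma clampE (r : R) : 0 <= r <= 1 -> clamp r = r :> R.
Proof. by case/andP => r0 r1; rewrite /clamp /= min_l// max_r. Qed.

Lemma maxminE (r : R) : 0 <= r <= 1 -> Num.max 0 (Num.min r 1) = r.
Proof. exact: clampE. Qed.

Lemma clampK (u : unit_itv) : clamp u = u.
Proof. by apply: val_inj; exact: clampE (uvalP u). Qed.

Lemma clamp_le0 (r : R) : r <= 0 -> clamp r = 0 :> R.
Proof. by move=> r0; rewrite /clamp /= max_l// ge_min r0. Qed.

Lemma clamp_ge1 (r : R) : 1 <= r -> clamp r = 1 :> R.
Proof. by move=> r1; rewrite /clamp /= min_r// max_r. Qed.

Lemma clamp_lip (r s : R) : `|(clamp r : R) - (clamp s : R)| <= `|r - s|.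
Proof.
have cl x : [\/ x <= 0 /\ clamp x = 0 :> R, 1 <= x /\ clamp x = 1 :> R
                | 0 <= x <= 1 /\ clamp x = x :> R].
  have [x0|x0] := leP x 0; first by apply: Or31; rewrite clamp_le0.
  have [x1|x1] := leP 1 x; first by apply: Or32; rewrite clamp_ge1.
  have x01 : 0 <= x <= 1 by rewrite !ltW.
  by apply: Or33; rewrite clampE.
have := ler_norm (r - s); have := ler_norm (s - r); rewrite (distrC s r).
by case: (cl r) => -[? ->]; case: (cl s) => -[? ->] ? ?; rewrite ler_norml; lra.
Qed.

End UnitInterval.

Section Cube.
Variables (R : realType) (k : nat).

Definition cube := {ffun 'I_k -> unit_itv R}.

HB.instance Definition _ := Choice.on cube.

Implicit Types x y z : cube.

Definition cube_dist (x y : cube) : R :=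
  Num.sqrt (\sum_i ((x i : R) - (y i : R)) ^+ 2).

Lemma cube_distxx x : cube_dist x x = 0.
Proof. by rewrite /cube_dist big1 ?sqrtr0// => i _; rewrite subrr expr0n. Qed.

Lemma cube_dist_coord x y i : `|(x i : R) - (y i : R)| <= cube_dist x y.
Proof.
rewrite -sqrtr_sqr ler_sqrt; last by apply: sumr_ge0 => j _; exact: sqr_ge0.
by rewrite (bigD1 i)//= lerDl; apply: sumr_ge0 => j _; exact: sqr_ge0.
Qed.

Lemma cube_dist_pos x y : cube_dist x y = 0 -> x = y.
Proof.
move=> xy0; apply/ffunP => i; apply/val_inj/eqP; rewrite -subr_eq0 -normr_le0.
by have := cube_dist_coord x y i; rewrite xy0.
Qed.

Lemma cube_dist_sym x y : cube_dist x y = cube_dist y x.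
Proof. by congr Num.sqrt; apply: eq_bigr => i _; rewrite -sqrrN opprB. Qed.

Lemma cube_dist_triangle y x z :
  cube_dist x z <= cube_dist x y + cube_dist y z.
Proof.
apply: le_trans (minkowski_sum _ _).
by rewrite le_eqVlt; apply/orP; left; apply/eqP; congr Num.sqrt;
  apply: eq_bigr => i _; congr (_ ^+ 2); ring.
Qed.

HB.instance Definition _ := @isMetric.Build R cube cube_dist
  cube_distxx cube_dist_pos cube_dist_sym cube_dist_triangle.

Definition cube_boundary : set cube :=
  [set x : cube | exists i, (x i : R) = 0 \/ (x i : R) = 1].

End Cube.

(* The product of two metric spaces with the distance
   sqrt (d(x,x')^2 + d(y,y')^2); the library's instance on X * Y is the maximum
   distance, hence the alias. *)
Section L2Product.
Variables (R : realType) (X Y : metricType R).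

Definition l2prod : Type := (X * Y)%type.

HB.instance Definition _ := Choice.on l2prod.

Definition l2dist (p q : l2prod) : R :=
  Num.sqrt (mdist p.1 q.1 ^+ 2 + mdist p.2 q.2 ^+ 2).

Lemma l2distxx p : l2dist p p = 0.
Proof. by rewrite /l2dist !mdistxx expr0n addr0 sqrtr0. Qed.

Lemma l2dist_fst p q : mdist p.1 q.1 <= l2dist p q.
Proof.
rewrite -[leLHS]ger0_norm ?mdist_ge0// -sqrtr_sqr ler_sqrt ?addr_ge0 ?sqr_ge0//.
by rewrite lerDl sqr_ge0.
Qed.

Lemma l2dist_snd p q : mdist p.2 q.2 <= l2dist p q.
Proof.
rewrite -[leLHS]ger0_norm ?mdist_ge0// -sqrtr_sqr ler_sqrt ?addr_ge0 ?sqr_ge0//.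
by rewrite lerDr sqr_ge0.
Qed.

Lemma l2dist_pos p q : l2dist p q = 0 -> p = q.
Proof.
move=> pq0; rewrite [p]surjective_pairing [q]surjective_pairing.
congr (_, _); apply: mdist_positivity; apply/le_anti; rewrite mdist_ge0 andbT.
  by rewrite -pq0 l2dist_fst.
by rewrite -pq0 l2dist_snd.
Qed.

Lemma l2dist_sym p q : l2dist p q = l2dist q p.
Proof. by rewrite /l2dist (metric_sym p.1) (metric_sym p.2). Qed.

Lemma le_l2 (a b c d : R) : 0 <= a -> 0 <= b -> a <= c -> b <= d ->
  Num.sqrt (a ^+ 2 + b ^+ 2) <= Num.sqrt (c ^+ 2 + d ^+ 2).
Proof.
move=> a0 b0 ac bd; rewrite ler_sqrt ?addr_ge0 ?sqr_ge0//.
by rewrite lerD// ler_sqr ?nnegrE//; lra.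
Qed.

Lemma l2dist_triangle q p r : l2dist p r <= l2dist p q + l2dist q r.
Proof.
apply: le_trans (minkowski2 _ _ _ _).
by apply: le_l2; rewrite ?mdist_ge0 ?metric_triangle.
Qed.

HB.instance Definition _ := @isMetric.Build R l2prod l2dist
  l2distxx l2dist_pos l2dist_sym l2dist_triangle.

End L2Product.

Section Heisenberg.
Variables (R : realType) (n : nat).

(* A point is ((x, y), t); the coordinates of R^(2n+1) are grouped as
   (x_1..x_n), (y_1..y_n), t. *)
Definition heis : Type := ('rV[R]_n * 'rV[R]_n * R)%type.

HB.instance Definition _ := Choice.on heis.

Definition hx (p : heis) (j : 'I_n) : R := p.1.1 ord0 j.
Definition hy (p : heis) (j : 'I_n) : R := p.1.2 ord0 j.
Definition ht (p : heis) : R := p.2.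

(* |z - z'| *)
Definition zdist (p q : heis) : R :=
  Num.sqrt (\sum_j ((hx p j - hx q j) ^+ 2 + (hy p j - hy q j) ^+ 2)).

(* the t-coordinate of q^-1 * p *)
Definition tdiff (p q : heis) : R :=
  ht p - ht q + 2 * \sum_j (hx q j * hy p j - hx p j * hy q j).

Definition koranyi (p q : heis) : R :=
  (zdist p q ^+ 4 + `|tdiff p q| ^+ 2) `^ 4^-1.

Lemma zdist2 p q : zdist p q ^+ 2 =
  \sum_j ((hx p j - hx q j) ^+ 2 + (hy p j - hy q j) ^+ 2).
Proof.
by rewrite sqr_sqrtr// sumr_ge0// => j _; rewrite addr_ge0 ?sqr_ge0.
Qed.

Lemma zdist_ge0 p q : 0 <= zdist p q. Proof. exact: sqrtr_ge0. Qed.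

Lemma koranyi_ge0 p q : 0 <= koranyi p q. Proof. exact: powR_ge0. Qed.

Lemma koranyi4 p q : koranyi p q ^+ 4 = (zdist p q ^+ 2) ^+ 2 + tdiff p q ^+ 2.
Proof.
rewrite /koranyi -powR_mulrn ?powR_ge0// -powRrM mulVf ?pnatr_eq0// powRr1.
  by rewrite -exprM real_normK ?num_real.
by rewrite addr_ge0 ?exprn_ge0 ?zdist_ge0.
Qed.

Lemma koranyi2 p q :
  koranyi p q ^+ 2 = Num.sqrt ((zdist p q ^+ 2) ^+ 2 + tdiff p q ^+ 2).
Proof.
by rewrite -koranyi4 (exprM _ 2 2) sqrtr_sqr ger0_norm// sqr_ge0.
Qed.

Lemma koranyixx p : koranyi p p = 0.
Proof.
have z0 : zdist p p = 0.
  by rewrite /zdist big1 ?sqrtr0// => j _; rewrite !subrr expr0n addr0.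
have t0 : tdiff p p = 0.
  rewrite /tdiff subrr big1 ?mulr0 ?addr0// => j _.
  by rewrite subrr.
by rewrite /koranyi z0 t0 normr0 !expr0n addr0 powR0// invr_eq0 pnatr_eq0.
Qed.

Lemma koranyi_pos p q : koranyi p q = 0 -> p = q.
Proof.
move=> pq0; have := koranyi4 p q; rewrite pq0 expr0n => /esym/eqP.
rewrite paddr_eq0 ?sqr_ge0// !sqrf_eq0 => /andP[/eqP z0 /eqP t0].
have := zdist2 p q; rewrite z0 expr0n => /esym s0.
have xy j : hx p j = hx q j /\ hy p j = hy q j.
  have /eqP : (hx p j - hx q j) ^+ 2 + (hy p j - hy q j) ^+ 2 = 0.
    by apply: (psumr_eq0P _ s0) => // i _; rewrite addr_ge0 ?sqr_ge0.
  rewrite paddr_eq0 ?sqr_ge0// !sqrf_eq0 !subr_eq0.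
  by case/andP => /eqP -> /eqP ->.
have tt : ht p = ht q.
  move: t0; rewrite /tdiff big1 ?mulr0 ?addr0; first by move/eqP; rewrite subr_eq0 => /eqP.
  by move=> j _; have [-> ->] := xy j; rewrite mulrC subrr.
move: p q xy tt {pq0 z0 t0 s0} => [[px py] pt] [[qx qy] qt] /= xy tt.
rewrite /hx /hy /= in xy; rewrite /ht /= in tt; rewrite tt.
by congr (_, _, _); apply/rowP => j; have [] := xy j.
Qed.

Lemma koranyi_sym p q : koranyi p q = koranyi q p.
Proof.
have zC : zdist p q = zdist q p.
  by congr Num.sqrt; apply: eq_bigr => j _; ring.
have tC : tdiff p q = - tdiff q p.
  rewrite /tdiff opprD opprB -mulrN -sumrN; congr (_ + 2 * _).
  by apply: eq_bigr => j _; ring.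
by rewrite /koranyi zC tC normrN.
Qed.

Lemma koranyi_triangle q p r : koranyi p r <= koranyi p q + koranyi q r.
Proof.
pose a j := hx p j - hx q j; pose b j := hy p j - hy q j.
pose c j := hx q j - hx r j; pose d j := hy q j - hy r j.
pose u := \sum_j (a j * c j + b j * d j).
pose v := \sum_j (a j * d j - b j * c j).
have zE : zdist p r ^+ 2 = zdist p q ^+ 2 + zdist q r ^+ 2 + 2 * u.
  rewrite !zdist2 /u mulr_sumr -!big_split; apply: eq_bigr => j _.
  by rewrite /a /b /c /d /=; ring.
have tE : tdiff p r = tdiff p q + tdiff q r + 2 * v.
  suff : \sum_j (hx r j * hy p j - hx p j * hy r j) =
      \sum_j (hx q j * hy p j - hx p j * hy q j) +
      \sum_j (hx r j * hy q j - hx q j * hy r j) + v.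
    by rewrite /tdiff => ->; ring.
  rewrite /v -!big_split; apply: eq_bigr => j _.
  by rewrite /a /b /c /d /=; ring.
have uv : Num.sqrt (u ^+ 2 + v ^+ 2) <= koranyi p q * koranyi q r.
  rewrite sqrt_le_sqr ?mulr_ge0 ?koranyi_ge0//.
  apply: le_trans (hermitian_CS _ _ _ _) _.
  rewrite -!zdist2 exprMn !koranyi2.
  rewrite ler_pM ?sqr_ge0// -[leLHS]ger0_norm ?sqr_ge0// -sqrtr_sqr.
    by rewrite ler_sqrt ?lerDl ?addr_ge0 ?sqr_ge0.
  by rewrite ler_sqrt ?lerDl ?addr_ge0 ?sqr_ge0.
rewrite -ler_sqr ?nnegrE ?addr_ge0 ?koranyi_ge0//.
rewrite koranyi2 zE tE.
apply: le_trans (minkowski2 _ _ _ _) _.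
have -> : (2 * u) ^+ 2 + (2 * v) ^+ 2 = 2 ^+ 2 * (u ^+ 2 + v ^+ 2) by ring.
rewrite sqrtrM ?sqr_ge0// sqrtr_sqr ger0_norm//.
have := minkowski2 (zdist p q ^+ 2) (zdist q r ^+ 2) (tdiff p q) (tdiff q r).
by rewrite -!koranyi2; lra.
Qed.

HB.instance Definition _ := @isMetric.Build R heis koranyi
  koranyixx koranyi_pos koranyi_sym koranyi_triangle.

End Heisenberg.

Section Hoelder.
Variable R : realType.

Definition holder (gamma : R) (X Y : metricType R) (f : X -> Y) : Prop :=
  exists C : R, forall x y : X, x != y ->
    mdist (f x) (f y) / mdist x y `^ gamma <= C.

Definition lip (X Y : metricType R) (f : X -> Y) : Prop :=
  exists2 L : R, 0 < L & forall x y, mdist (f x) (f y) <= L * mdist x y.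

Variables (gamma : {posnum R}) (X Y : metricType R).
Local Notation g := (gamma%:num).

Lemma holderP (f : X -> Y) : holder g f <->
  exists2 C : R, 0 <= C & forall x y, mdist (f x) (f y) <= C * mdist x y `^ g.
Proof.
split=> [[C fC]|[C C0 fC]].
  exists (Num.max 0 C); first by rewrite le_max lexx.
  move=> x y; have [->|xy] := eqVneq x y.
    by rewrite !mdistxx mulr_ge0 ?powR_ge0// le_max lexx.
  have d0 : 0 < mdist x y `^ g by rewrite powR_gt0// mdist_gt0.
  by rewrite -ler_pdivrMr// (le_trans (fC _ _ xy))// le_max lexx orbT.
exists C => x y xy; have d0 : 0 < mdist x y `^ g by rewrite powR_gt0// mdist_gt0.
by rewrite ler_pdivrMr.
Qed.

End Hoelder.

Section HoelderComp.
Variables (R : realType) (gamma : {posnum R}) (X Y Z : metricType R).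
Local Notation g := (gamma%:num).

Lemma le_powRg (a b : R) : 0 <= a -> a <= b -> a `^ g <= b `^ g.
Proof. by move=> a0 ab; rewrite ge0_ler_powR ?nnegrE// (le_trans a0). Qed.

Lemma holder_comp_lip (f : Y -> Z) (h : X -> Y) :
  holder g f -> lip h -> holder g (fun x => f (h x)).
Proof.
move=> /holderP[C C0 fC] [L L0 hL]; apply/holderP.
exists (C * L `^ g); first by rewrite mulr_ge0 ?powR_ge0.
move=> x y; apply: le_trans (fC _ _) _; rewrite -mulrA ler_wpM2l//.
by rewrite -powRM ?mdist_ge0 ?(ltW L0)// le_powRg ?mdist_ge0.
Qed.

Lemma holder_cst (y0 : Y) : holder g (fun _ : X => y0).
Proof. by apply/holderP; exists 0 => // x y; rewrite mdistxx mul0r. Qed.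

Lemma holder_glue (A : pred X) (f1 f2 : X -> Y) :
  holder g f1 -> holder g f2 ->
  (forall x y, A x -> ~~ A y -> exists m, [/\ mdist x m <= mdist x y,
     mdist m y <= mdist x y & f1 m = f2 m]) ->
  holder g (fun x => if A x then f1 x else f2 x).
Proof.
move=> /holderP[C1 C10 h1] /holderP[C2 C20 h2] mid; apply/holderP.
have ac x y : A x -> ~~ A y ->
    mdist (f1 x) (f2 y) <= (C1 + C2) * mdist x y `^ g.
  move=> Ax Ay; have [m [xm my e]] := mid _ _ Ax Ay.
  rewrite (le_trans (metric_triangle _ (f1 m) _))// mulrDl lerD//.
    by rewrite (le_trans (h1 _ _))// ler_wpM2l// le_powRg ?mdist_ge0.
  by rewrite e (le_trans (h2 _ _))// ler_wpM2l// le_powRg ?mdist_ge0.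
exists (C1 + C2); first by rewrite addr_ge0.
move=> x y; case: ifPn => Ax; case: ifPn => Ay.
- by rewrite (le_trans (h1 _ _))// ler_wpM2r ?powR_ge0// lerDl.
- exact: ac.
- by rewrite metric_sym (metric_sym x) ac.
- by rewrite (le_trans (h2 _ _))// ler_wpM2r ?powR_ge0// lerDr.
Qed.

End HoelderComp.

Section Loops.
Variables (R : realType) (gamma : {posnum R}) (X : metricType R) (x0 : X).
Variable k : nat.
Local Notation g := (gamma%:num).
Local Notation I := (unit_itv R).
Local Notation cube := (cube R k).

Definition near_boundary (f : cube -> X) : Prop :=
  exists U : set cube,
    [/\ open U, @cube_boundary R k `<=` U & forall x, U x -> f x = x0].

Record holder_loop := HolderLoop {
  loop_fun :> cube -> X ;
  loop_holder : holder g loop_fun ;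
  loop_base : near_boundary loop_fun }.

HB.instance Definition _ := gen_eqMixin holder_loop.
HB.instance Definition _ := gen_choiceMixin holder_loop.

Definition homotopic (f h : holder_loop) : Prop :=
  exists H : l2prod I cube -> X,
    [/\ holder g H,
        forall x, H (clamp 0, x) = f x,
        forall x, H (clamp 1, x) = h x &
        forall t, near_boundary (fun x => H (t, x))].

Lemma near_boundaryP (f : cube -> X) : near_boundary f <->
  forall b, @cube_boundary R k b ->
    exists2 e : R, 0 < e & forall x, mdist b x < e -> f x = x0.
Proof.
split=> [[U [oU bU fU]] b /bU Ub|fb].
  move: oU; rewrite openE => /(_ b Ub).
  rewrite /interior -nbhs_ballE => -[e /= e0 eU].
  by exists e => // x bx; apply: fU; apply: eU; rewrite ballEmdist.
exists ([set x | f x = x0]^°); split.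
- exact: open_interior.
- move=> b /fb[e e0 be]; rewrite /interior -nbhs_ballE; exists e; first exact: e0.
  by rewrite ballEmdist => x; exact: be.
- by move=> x /interior_subset.
Qed.

Lemma near_boundary_val (f : cube -> X) b :
  near_boundary f -> @cube_boundary R k b -> f b = x0.
Proof.
by move=> /near_boundaryP fb /fb[e e0]; apply; rewrite mdistxx.
Qed.

Lemma near_boundary_lip (f : cube -> X) (h : cube -> cube) :
  near_boundary f -> lip h ->
  (forall b, @cube_boundary R k b -> @cube_boundary R k (h b)) ->
  near_boundary (fun x => f (h x)).
Proof.
move=> /near_boundaryP fb [L L0 hL] hb; apply/near_boundaryP => b /hb/fb[e e0 fe].
exists (e / L); first by rewrite divr_gt0.
move=> x bx; apply: fe; apply: le_lt_trans (hL _ _) _.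
by rewrite mulrC -ltr_pdivlMr.
Qed.

Lemma near_boundary_if (A : pred cube) (f h : cube -> X) :
  near_boundary f -> near_boundary h ->
  near_boundary (fun x => if A x then f x else h x).
Proof.
move=> /near_boundaryP fb /near_boundaryP hb; apply/near_boundaryP => b bb.
have [e e0 fe] := fb _ bb; have [d d0 hd] := hb _ bb.
exists (Num.min e d); first by rewrite lt_min e0.
by move=> x; rewrite lt_min => /andP[/fe -> /hd ->]; case: ifP.
Qed.

Lemma near_boundary_cst : near_boundary (fun=> x0).
Proof. by exists setT; split => //; exact: openT. Qed.

Definition loop_cst := HolderLoop (@holder_cst _ gamma _ _ x0) near_boundary_cst.

Lemma mdist_itvE (s t : I) : mdist s t = `|(s : R) - (t : R)|.
Proof. by []. Qed.

Lemma mdist_cubeE (x y : cube) :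
  mdist x y = Num.sqrt (\sum_i ((x i : R) - (y i : R)) ^+ 2).
Proof. by []. Qed.

Lemma mdist_l2E (S T : metricType R) (p q : l2prod S T) :
  mdist p q = Num.sqrt (mdist p.1 q.1 ^+ 2 + mdist p.2 q.2 ^+ 2).
Proof. by []. Qed.

Lemma lip_snd (T : metricType R) : lip (fun p : l2prod T cube => p.2).
Proof. by exists 1 => // p q; rewrite mul1r; exact: l2dist_snd. Qed.

Lemma lip_time (phi : R -> R) (L : R) : 0 <= L ->
  (forall r s, `|phi r - phi s| <= L * `|r - s|) ->
  lip (fun p : l2prod I cube => (clamp (phi p.1), p.2) : l2prod I cube).
Proof.
move=> L0 phiL; exists (L + 1); first by rewrite ltr_wpDl.
move=> p q; rewrite !mdist_l2E /=.
have h := mdist_ge0 p.1 q.1; have h' := mdist_ge0 p.2 q.2.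
set d1 := mdist p.1 q.1 in h *; set d2 := mdist p.2 q.2 in h' *.
rewrite -[X in X * _]ger0_norm ?addr_ge0// -sqrtr_sqr -sqrtrM ?sqr_ge0//.
rewrite mulrDr -!exprMn; apply: le_l2; rewrite ?mdist_ge0//.
  apply: le_trans (clamp_lip _ _) _; apply: le_trans (phiL _ _) _.
  by rewrite mulrDl mul1r -[leLHS]addr0 lerD.
by rewrite mulrDl mul1r lerDr mulr_ge0.
Qed.

Lemma homotopic_refl f : homotopic f f.
Proof.
exists (fun p => f p.2); split => //= [|t].
  exact: holder_comp_lip (loop_holder f) (@lip_snd _).
exact: loop_base.
Qed.

Lemma homotopic_sym f h : homotopic f h -> homotopic h f.
Proof.
move=> [H [Hh H0 H1 Hb]].
exists (fun p : l2prod I cube => H (clamp (1 - (p.1 : R)), p.2)); split => /=.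
- apply: holder_comp_lip Hh _; apply: (@lip_time (fun r => 1 - r) 1) => // r s.
  by rewrite mul1r opprB addrC addrA subrK distrC.
- by move=> x; rewrite maxminE ?lexx ?ler01// subr0 H1.
- by move=> x; rewrite maxminE ?lexx ?ler01// subrr H0.
- by move=> t; exact: Hb.
Qed.

Lemma homotopic_trans f h l : homotopic f h -> homotopic h l -> homotopic f l.
Proof.
move=> [H [Hh H0 H1 Hb]] [K [Kh K0 K1 Kb]].
pose H' (p : l2prod I cube) := H (clamp (2 * (p.1 : R)), p.2).
pose K' (p : l2prod I cube) := K (clamp (2 * (p.1 : R) - 1), p.2).
have lip2 a : forall r s : R, `|(2 * r - a) - (2 * s - a)| <= 2 * `|r - s|.
  move=> r s; have -> : 2 * r - a - (2 * s - a) = 2 * (r - s) by ring.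
  by rewrite normrM ger0_norm.
exists (fun p : l2prod I cube => if (p.1 : R) <= 2^-1 then H' p else K' p); split.
- apply: (@holder_glue _ _ _ _ (fun p : l2prod I cube => (p.1 : R) <= 2^-1)).
  + apply: holder_comp_lip Hh _; apply: (@lip_time (fun r => 2 * r) 2) => // r s.
    by have := lip2 0 r s; rewrite !subr0.
  + apply: holder_comp_lip Kh _; exact: (@lip_time (fun r => 2 * r - 1) 2).
  + move=> p q /= ps; rewrite -ltNge => qs; exists (clamp 2^-1, q.2); split.
    * rewrite !mdist_l2E; apply: le_l2; rewrite ?mdist_ge0//=.
      rewrite !mdist_itvE ?(clampE, maxminE); last by lra.
      by rewrite !ler0_norm; lra.
    * rewrite !mdist_l2E; apply: le_l2; rewrite ?mdist_ge0//= ?mdistxx ?mdist_ge0//.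
      rewrite !mdist_itvE ?(clampE, maxminE); last by lra.
      by rewrite !ler0_norm; lra.
    * rewrite /H' /K' /= maxminE; last by lra.
      have -> : 2 * 2^-1 = 1 :> R by lra.
      by rewrite subrr H1 K0.
- move=> x /=; rewrite maxminE ?lexx ?ler01// invr_ge0 ler0n /H' /= maxminE ?lexx ?ler01//.
  by rewrite mulr0.
- move=> x /=; rewrite maxminE ?lexx ?ler01//.
  have -> : (1 <= 2^-1 :> R) = false by apply/negP; lra.
  rewrite /K' /= maxminE ?lexx ?ler01//.
  by have -> : 2 * 1 - 1 = 1 :> R by lra.
- move=> t; apply: (@near_boundary_if (fun=> (t : R) <= 2^-1)).
  + exact: (Hb (clamp (2 * (t : R)))).
  + exact: (Kb (clamp (2 * (t : R) - 1))).
Qed.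

Definition homotopicb (f h : holder_loop) : bool := `[< homotopic f h >].

Lemma homotopicb_equiv : equiv_class_of homotopicb.
Proof.
split.
- by move=> f; apply/asboolP; exact: homotopic_refl.
- by move=> f h; apply/idP/idP => /asboolP fh; apply/asboolP;
  exact: homotopic_sym.
- move=> h f l /asboolP fh /asboolP hl; apply/asboolP.
  exact: homotopic_trans fh hl.
Qed.

Canonical homotopic_equiv := EquivRelPack homotopicb_equiv.

Definition holder_pi := {eq_quot homotopic_equiv}.

HB.instance Definition _ := Choice.on holder_pi.

Definition loop_class (f : holder_loop) : holder_pi := \pi f.

Lemma loop_classK (a : holder_pi) : loop_class (repr a) = a.
Proof. exact: reprK. Qed.

Lemma loop_classP (f h : holder_loop) :
  loop_class f = loop_class h <-> homotopic f h.
Proof.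
split=> [/eqmodP/asboolP//|fh].
by apply/eqmodP; apply/asboolP.
Qed.

End Loops.

Section FirstCoordinate.
Variables (R : realType) (k : nat).
Local Notation cube := (cube R k.+1).
Implicit Types x y : cube.

Definition set_first (r : R) (x : cube) : cube :=
  [ffun i => if i == ord0 then clamp r else x i].

Lemma set_first0 r x : 0 <= r <= 1 -> (set_first r x ord0 : R) = r.
Proof. by move=> r01; rewrite ffunE eqxx clampE. Qed.

Lemma set_first_id x : set_first (x ord0) x = x.
Proof. by apply/ffunP => i; rewrite ffunE; case: eqP => // ->; rewrite clampK. Qed.

Lemma set_first_set r s x : set_first r (set_first s x) = set_first r x.
Proof. by apply/ffunP => i; rewrite !ffunE; case: eqP. Qed.

Lemma lip_cube (T : metricType R) (h : T -> cube) (L : R) : 0 < L ->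
  (forall p q i, `|(h p i : R) - (h q i : R)| <= L * mdist p q) -> lip h.
Proof.
move=> L0 hL; exists (k.+1%:R * L); first by rewrite mulr_gt0.
move=> p q; rewrite mdist_cubeE sqrt_le_sqr ?mulr_ge0 ?mdist_ge0 ?(ltW L0)//.
apply: (@le_trans _ _ (\sum_(i < k.+1) (L * mdist p q) ^+ 2)).
  apply: ler_sum => i _; rewrite -real_normK ?num_real//.
  by rewrite ler_sqr ?nnegrE// mulr_ge0 ?mdist_ge0 ?(ltW L0).
rewrite sumr_const card_ord -[leLHS]mulr_natl -[X in _ <= X ^+ 2]mulrA.
rewrite [leRHS]exprMn ler_wpM2r ?sqr_ge0//.
by rewrite -natrX ler_nat leq_pmulr.
Qed.

Lemma lip_set_first (T : metricType R) (phi : T -> R) (h : T -> cube) (L : R) :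
  0 <= L -> (forall p q, `|phi p - phi q| <= L * mdist p q) ->
  (forall p q i, `|(h p i : R) - (h q i : R)| <= mdist p q) ->
  lip (fun p => set_first (phi p) (h p)).
Proof.
move=> L0 phiL hL; apply: (@lip_cube _ _ (L + 1)); first by rewrite ltr_wpDl.
move=> p q i; rewrite !ffunE mulrDl mul1r; have d0 := mdist_ge0 p q.
case: eqP => _.
  by rewrite (le_trans (clamp_lip _ _))// (le_trans (phiL _ _))// lerDl.
by rewrite (le_trans (hL _ _ _))// lerDr mulr_ge0.
Qed.

Lemma mdist_coord (x y : cube) i : `|(x i : R) - (y i : R)| <= mdist x y.
Proof. exact: cube_dist_coord. Qed.

Lemma mdist_half1 (x y : cube) : (x ord0 : R) <= 2^-1 -> 2^-1 < (y ord0 : R) ->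
  mdist x (set_first 2^-1 y) <= mdist x y.
Proof.
move=> xh yh; rewrite !mdist_cubeE ler_sqrt; last first.
  by apply: sumr_ge0 => i _; exact: sqr_ge0.
apply: ler_sum => i _; rewrite ffunE; case: eqP => // ->; rewrite clampE; last by lra.
by rewrite -ler_sqrt ?sqr_ge0// !sqrtr_sqr !ler0_norm; lra.
Qed.

Lemma mdist_half2 (x y : cube) : (x ord0 : R) <= 2^-1 -> 2^-1 < (y ord0 : R) ->
  mdist (set_first 2^-1 y) y <= mdist x y.
Proof.
move=> xh yh; rewrite !mdist_cubeE ler_sqrt; last first.
  by apply: sumr_ge0 => i _; exact: sqr_ge0.
apply: ler_sum => i _; rewrite ffunE; case: eqP => [->|_].
  rewrite clampE; last by lra.
  by rewrite -ler_sqrt ?sqr_ge0// !sqrtr_sqr !ler0_norm; lra.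
by rewrite subrr expr0n sqr_ge0.
Qed.

Lemma boundary_set_first (x : cube) (r : R) : cube_boundary x ->
  ((x ord0 : R) = 0 \/ (x ord0 : R) = 1 ->
    (clamp r : R) = 0 \/ (clamp r : R) = 1) ->
  cube_boundary (set_first r x).
Proof.
move=> [i xi] rb; have [i0|i0] := eqVneq i ord0.
  by exists ord0; rewrite ffunE eqxx; apply: rb; rewrite -i0.
by exists i; rewrite ffunE (negbTE i0).
Qed.

Lemma boundary_set_first0 (x : cube) (r : R) : r <= 0 \/ 1 <= r ->
  cube_boundary (set_first r x).
Proof.
move=> r01; exists ord0; rewrite ffunE eqxx.
by case: r01 => [/clamp_le0|/clamp_ge1] ->; [left|right].
Qed.

Definition lip2 (phi : R -> R) := forall r s, `|phi r - phi s| <= 2 * `|r - s|.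

Lemma lip2_affine (a b : R) : `|a| <= 2 -> lip2 (fun r => a * r + b).
Proof.
move=> a2 r s; have -> : a * r + b - (a * s + b) = a * (r - s) by ring.
by rewrite normrM ler_wpM2r.
Qed.

Lemma lip2_min (phi psi : R -> R) : lip2 phi -> lip2 psi ->
  lip2 (fun r => Num.min (phi r) (psi r)).
Proof.
move=> hp hq r s; move: (hp r s) (hq r s); rewrite !ler_norml.
by case: (leP (phi r)) => ?; case: (leP (phi s)) => ?; lra.
Qed.

Lemma lip2_max (phi psi : R -> R) : lip2 phi -> lip2 psi ->
  lip2 (fun r => Num.max (phi r) (psi r)).
Proof.
move=> hp hq r s; move: (hp r s) (hq r s); rewrite !ler_norml.
by case: (leP (phi r)) => ?; case: (leP (phi s)) => ?; lra.
Qed.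

End FirstCoordinate.

Section Group.
Variables (R : realType) (gamma : {posnum R}) (X : metricType R) (x0 : X).
Variable k : nat.
Local Notation g := (gamma%:num).
Local Notation I := (unit_itv R).
Local Notation cube := (cube R k.+1).
Local Notation loop := (holder_loop gamma x0 k.+1).
Local Notation pi := (holder_pi gamma x0 k.+1).

(* The first coordinate set_first receives here lies in [0,1]. *)
Definition concat_fun (f h : cube -> X) (x : cube) : X :=
  if (x ord0 : R) <= 2^-1 then f (set_first (2 * (x ord0 : R)) x)
  else h (set_first (2 * (x ord0 : R) - 1) x).

Lemma lip_affine (a b : R) : `|a| <= 2 ->
  lip (fun x : cube => set_first (a * (x ord0 : R) + b) x).
Proof.
move=> a2; apply: (@lip_set_first _ _ _ _ _ 2) => //.
- move=> p q; apply: le_trans (lip2_affine _ a2 _ _) _.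
  by rewrite ler_wpM2l// mdist_coord.
- exact: mdist_coord.
Qed.

Lemma lip_first2 : lip (fun x : cube => set_first (2 * (x ord0 : R)) x).
Proof.
have := @lip_affine 2 0; rewrite ger0_norm// lexx => /(_ isT).
by under eq_fun do rewrite addr0.
Qed.

Lemma lip_first2B1 : lip (fun x : cube => set_first (2 * (x ord0 : R) - 1) x).
Proof. by apply: lip_affine; rewrite ger0_norm. Qed.

Lemma boundary_first2 (b : cube) : cube_boundary b ->
  cube_boundary (set_first (2 * (b ord0 : R)) b).
Proof.
move=> bb; apply: boundary_set_first => // -[] ->.
  by left; apply: clamp_le0; lra.
by right; apply: clamp_ge1; lra.
Qed.

Lemma boundary_first2B1 (b : cube) : cube_boundary b ->
  cube_boundary (set_first (2 * (b ord0 : R) - 1) b).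
Proof.
move=> bb; apply: boundary_set_first => // -[] ->.
  by left; apply: clamp_le0; lra.
by right; apply: clamp_ge1; lra.
Qed.

Lemma concat_holder (f h : loop) : holder g (concat_fun f h).
Proof.
apply: (@holder_glue _ _ _ _ (fun x : cube => (x ord0 : R) <= 2^-1)
  (fun x => f (set_first (2 * (x ord0 : R)) x))
  (fun x => h (set_first (2 * (x ord0 : R) - 1) x))).
- exact: holder_comp_lip (loop_holder f) lip_first2.
- exact: holder_comp_lip (loop_holder h) lip_first2B1.
- move=> x y xh; rewrite -ltNge => yh; exists (set_first 2^-1 y); split.
  + exact: mdist_half1.
  + exact: mdist_half2.
  + rewrite set_first0; last by lra.
    rewrite (near_boundary_val (loop_base f)) ?(near_boundary_val (loop_base h))//.
      by apply: boundary_set_first0; left; lra.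
    by apply: boundary_set_first0; right; lra.
Qed.

Lemma concat_base (f h : loop) : near_boundary x0 (concat_fun f h).
Proof.
apply: (@near_boundary_if _ _ _ _ (fun x : cube => (x ord0 : R) <= 2^-1)
  (fun x => f (set_first (2 * (x ord0 : R)) x))
  (fun x => h (set_first (2 * (x ord0 : R) - 1) x))).
- exact: near_boundary_lip (loop_base f) lip_first2 boundary_first2.
- exact: near_boundary_lip (loop_base h) lip_first2B1 boundary_first2B1.
Qed.

Definition loop_concat (f h : loop) : loop :=
  HolderLoop (concat_holder f h) (concat_base f h).

Lemma lip_firstN : lip (fun x : cube => set_first (1 - (x ord0 : R)) x).
Proof.
have := @lip_affine (-1) 1; rewrite normrN1 ler1n => /(_ isT).
by under eq_fun do rewrite mulN1r addrC.
Qed.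

Lemma boundary_firstN (b : cube) : cube_boundary b ->
  cube_boundary (set_first (1 - (b ord0 : R)) b).
Proof.
move=> bb; apply: boundary_set_first => // -[] ->.
  by right; apply: clamp_ge1; lra.
by left; apply: clamp_le0; lra.
Qed.

Definition loop_inverse (f : loop) : loop :=
  HolderLoop (holder_comp_lip (loop_holder f) lip_firstN)
    (near_boundary_lip (loop_base f) lip_firstN boundary_firstN).

Lemma homotopic_concat (f f' h h' : loop) : homotopic f f' -> homotopic h h' ->
  homotopic (loop_concat f h) (loop_concat f' h').
Proof.
move=> [H [Hh H0 H1 Hb]] [K [Kh K0 K1 Kb]].
have lipt (s : R -> R) : lip (fun x : cube => set_first (s (x ord0)) x) ->
    lip (fun p : l2prod I cube =>
      (p.1, set_first (s (p.2 ord0)) p.2) : l2prod I cube).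
  move=> [L L0 sL]; exists (L + 1); first by rewrite addr_gt0.
  move=> p q; rewrite !mdist_l2E /=.
  have h1 := mdist_ge0 p.1 q.1; have h2 := mdist_ge0 p.2 q.2.
  rewrite -[X in X * _]ger0_norm ?addr_ge0 ?(ltW L0)//.
  rewrite -sqrtr_sqr -sqrtrM ?sqr_ge0//.
  rewrite mulrDr -!exprMn; apply: le_l2; rewrite ?mdist_ge0//.
    by rewrite mulrDl mul1r lerDr mulr_ge0// ltW.
  by rewrite (le_trans (sL _ _))// mulrDl mul1r lerDl.
exists (fun p : l2prod I cube =>
  if (p.2 ord0 : R) <= 2^-1 then H (p.1, set_first (2 * (p.2 ord0 : R)) p.2)
  else K (p.1, set_first (2 * (p.2 ord0 : R) - 1) p.2)); split.
- apply: (@holder_glue _ _ _ _ (fun p : l2prod I cube => (p.2 ord0 : R) <= 2^-1)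
    (fun p => H (p.1, set_first (2 * (p.2 ord0 : R)) p.2))
    (fun p => K (p.1, set_first (2 * (p.2 ord0 : R) - 1) p.2))).
  + exact: holder_comp_lip Hh (lipt (fun r => 2 * r) lip_first2).
  + exact: holder_comp_lip Kh (lipt (fun r => 2 * r - 1) lip_first2B1).
  + move=> p q ph; rewrite -ltNge => qh; exists (q.1, set_first 2^-1 q.2); split.
    * by rewrite !mdist_l2E; apply: le_l2; rewrite ?mdist_ge0//= mdist_half1.
    * rewrite !mdist_l2E; apply: le_l2; rewrite ?mdist_ge0//= ?mdist_half2//.
      by rewrite mdistxx mdist_ge0.
    * rewrite /= set_first0; last by lra.
      rewrite (near_boundary_val (Hb q.1)); last first.
        by apply: boundary_set_first0; right; lra.
      rewrite (near_boundary_val (Kb q.1))//.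
      by apply: boundary_set_first0; left; lra.
- by move=> x; rewrite /= /concat_fun; case: ifP => _; rewrite ?H0 ?K0.
- by move=> x; rewrite /= /concat_fun; case: ifP => _; rewrite ?H1 ?K1.
- move=> t.
  apply: (@near_boundary_if _ _ _ _ (fun x : cube => (x ord0 : R) <= 2^-1)
    (fun x => H (t, set_first (2 * (x ord0 : R)) x))
    (fun x => K (t, set_first (2 * (x ord0 : R) - 1) x))).
  + exact: near_boundary_lip (Hb t) lip_first2 boundary_first2.
  + exact: near_boundary_lip (Kb t) lip_first2B1 boundary_first2B1.
Qed.

Lemma homotopic_inverse (f f' : loop) : homotopic f f' ->
  homotopic (loop_inverse f) (loop_inverse f').
Proof.
move=> [H [Hh H0 H1 Hb]].
exists (fun p : l2prod I cube => H (p.1, set_first (1 - (p.2 ord0 : R)) p.2)).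
split => /=.
- apply: holder_comp_lip Hh _; have [L L0 sL] := lip_firstN.
  exists (L + 1); first by rewrite addr_gt0.
  move=> p q; rewrite !mdist_l2E /=.
  have h1 := mdist_ge0 p.1 q.1; have h2 := mdist_ge0 p.2 q.2.
  rewrite -[X in X * _]ger0_norm ?addr_ge0 ?(ltW L0)//.
  rewrite -sqrtr_sqr -sqrtrM ?sqr_ge0//.
  rewrite mulrDr -!exprMn; apply: le_l2; rewrite ?mdist_ge0//.
    by rewrite mulrDl mul1r lerDr mulr_ge0// ltW.
  by rewrite (le_trans (sL _ _))// mulrDl mul1r lerDl.
- by move=> x; rewrite H0.
- by move=> x; rewrite H1.
- by move=> t; exact: near_boundary_lip (Hb t) lip_firstN boundary_firstN.
Qed.

Lemma homotopic_reparam (f u v : loop) (phi psi : R -> R) :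
  lip2 phi -> lip2 psi ->
  (forall r, 0 <= r <= 1 -> 0 <= phi r <= 1) ->
  (forall r, 0 <= r <= 1 -> 0 <= psi r <= 1) ->
  phi 0 = psi 0 -> phi 1 = psi 1 ->
  phi 0 = 0 \/ phi 0 = 1 -> phi 1 = 0 \/ phi 1 = 1 ->
  (forall x, u x = f (set_first (phi (x ord0)) x)) ->
  (forall x, v x = f (set_first (psi (x ord0)) x)) ->
  homotopic u v.
Proof.
move=> lphi lpsi phi01 psi01 e0 e1 b0 b1 uE vE.
pose w (t : I) (x : cube) :=
  (1 - (t : R)) * phi (x ord0) + (t : R) * psi (x ord0).
exists (fun p : l2prod I cube => f (set_first (w p.1 p.2) p.2)); split.
- apply: holder_comp_lip (loop_holder f) _.
  apply: (@lip_set_first _ _ _ _ _ 3) => //; last first.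
    by move=> p q i; apply: le_trans (mdist_coord _ _ _) (l2dist_snd _ _).
  move=> p q; rewrite /w.
  set s := p.1; set t := q.1; set x : R := p.2 ord0; set y : R := q.2 ord0.
  have -> : (1 - (s : R)) * phi x + (s : R) * psi x
      - ((1 - (t : R)) * phi y + (t : R) * psi y)
    = (1 - (s : R)) * (phi x - phi y) + (s : R) * (psi x - psi y)
      + ((t : R) - (s : R)) * (phi y - psi y) by ring.
  have s01 := uvalP s.
  have y01 : 0 <= y <= 1 by exact: uvalP.
  have hx : `|x - y| <= mdist p q.
    by apply: le_trans (mdist_coord _ _ _) (l2dist_snd _ _).
  have ht : `|(t : R) - (s : R)| <= mdist p q.
    by rewrite distrC; exact: (l2dist_fst p q).
  have d1 : `|(1 - (s : R)) * (phi x - phi y)| <= (1 - (s : R)) * (2 * `|x - y|).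
    rewrite normrM ger0_norm; last by lra.
    by rewrite ler_wpM2l ?lphi//; lra.
  have d2 : `|(s : R) * (psi x - psi y)| <= (s : R) * (2 * `|x - y|).
    rewrite normrM ger0_norm; last by lra.
    by rewrite ler_wpM2l ?lpsi//; lra.
  have d3 : `|((t : R) - (s : R)) * (phi y - psi y)| <= `|(t : R) - (s : R)|.
    rewrite normrM ler_piMr// ler_norml.
    by have := phi01 _ y01; have := psi01 _ y01; lra.
  apply: le_trans (ler_normD _ _) _.
  have := ler_normD ((1 - (s : R)) * (phi x - phi y)) ((s : R) * (psi x - psi y)).
  by lra.
- by move=> x; rewrite uE /= /w clampE ?lexx ?ler01// subr0 mul1r mul0r addr0.
- by move=> x; rewrite vE /= /w clampE ?lexx ?ler01// subrr mul1r mul0r add0r.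
- move=> t; have t01 := uvalP t.
  apply: (near_boundary_lip (loop_base f)).
    apply: (@lip_set_first _ _ _ _ _ 2) => //; last exact: mdist_coord.
    move=> p q; rewrite /w.
    set x : R := p ord0; set y : R := q ord0.
    have -> : (1 - (t : R)) * phi x + (t : R) * psi x
      - ((1 - (t : R)) * phi y + (t : R) * psi y)
      = (1 - (t : R)) * (phi x - phi y) + (t : R) * (psi x - psi y) by ring.
    have hx : `|x - y| <= mdist p q by exact: mdist_coord.
    apply: le_trans (ler_normD _ _) _; rewrite !normrM.
    rewrite (ger0_norm (_ : 0 <= 1 - (t : R))); last by lra.
    rewrite (ger0_norm (_ : 0 <= (t : R))); last by lra.
    have d1 : (1 - (t : R)) * `|phi x - phi y| <= (1 - (t : R)) * (2 * `|x - y|).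
      by rewrite ler_wpM2l ?lphi//; lra.
    have d2 : (t : R) * `|psi x - psi y| <= (t : R) * (2 * `|x - y|).
      by rewrite ler_wpM2l ?lpsi//; lra.
    by lra.
  move=> b bb; apply: boundary_set_first => //; rewrite /w.
  have wE a : (1 - (t : R)) * a + (t : R) * a = a by ring.
  case=> ->.
    rewrite -e0 wE; case: b0 => ->; [left|right]; rewrite clampE//;
      by rewrite ?lexx ?ler01.
  rewrite -e1 wE; case: b1 => ->; [left|right]; rewrite clampE//;
    by rewrite ?lexx ?ler01.
Qed.

Lemma loop_val0 (f : loop) (r : R) x : r <= 0 \/ 1 <= r -> f (set_first r x) = x0.
Proof.
by move=> r01; rewrite (near_boundary_val (loop_base f))//; exact: boundary_set_first0.
Qed.

Lemma lip2_id : lip2 (fun r : R => r).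
Proof. by move=> r s; rewrite ler_peMl// ler1n. Qed.

Lemma lip2_2 : lip2 (fun r : R => 2 * r).
Proof.
have := @lip2_affine R 2 0; rewrite ger0_norm// lexx => /(_ isT) h r s.
by have := h r s; rewrite !addr0.
Qed.

Lemma lip2_cst (c : R) : lip2 (fun=> c).
Proof. by move=> r s; rewrite subrr normr0 mulr_ge0. Qed.

Lemma concat_idr (f : loop) : homotopic (loop_concat f (loop_cst gamma x0 k.+1)) f.
Proof.
apply: (@homotopic_reparam f _ _ (fun r => Num.min (2 * r) 1) (fun r => r)).
- by apply: lip2_min; [exact: lip2_2|exact: lip2_cst].
- exact: lip2_id.
- by move=> r r01; case: (leP (2 * r) 1) => ?; lra.
- by [].
- by rewrite mulr0 min_l.
- by rewrite min_r// mulr1 ler1n.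
- by left; rewrite mulr0 min_l.
- by right; rewrite min_r// mulr1 ler1n.
- move=> x; rewrite /= /concat_fun; case: ifPn => xh.
    by rewrite min_l//; lra.
  rewrite -ltNge in xh; rewrite min_r; last by lra.
  by rewrite loop_val0//; right.
- by move=> x; rewrite set_first_id.
Qed.

Lemma concat_idl (f : loop) : homotopic (loop_concat (loop_cst gamma x0 k.+1) f) f.
Proof.
apply: (@homotopic_reparam f _ _ (fun r => Num.max (2 * r - 1) 0) (fun r => r)).
- apply: lip2_max; last exact: lip2_cst.
  by apply: lip2_affine; rewrite ger0_norm.
- exact: lip2_id.
- by move=> r r01; case: (leP (2 * r - 1) 0) => ?; lra.
- by [].
- by rewrite max_r//; lra.
- by rewrite max_l; lra.
- by left; rewrite max_r//; lra.
- by right; rewrite max_l; lra.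
- move=> x; rewrite /= /concat_fun; case: ifPn => xh.
    by rewrite max_r ?loop_val0//; [left|lra].
  by rewrite -ltNge in xh; rewrite max_l//; lra.
- by move=> x; rewrite set_first_id.
Qed.

Lemma concatA (f h l : loop) :
  homotopic (loop_concat f (loop_concat h l)) (loop_concat (loop_concat f h) l).
Proof.
apply/homotopic_sym.
apply: (@homotopic_reparam (loop_concat f (loop_concat h l)) _ _
  (fun r => Num.min (2 * r) (Num.min (1 * r + 4^-1) (2^-1 * r + 2^-1)))
  (fun r => r)).
- apply: lip2_min; first exact: lip2_2.
  by apply: lip2_min; apply: lip2_affine; rewrite ger0_norm//; lra.
- exact: lip2_id.
- by move=> r r01; case: (leP (1 * r + 4^-1) (2^-1 * r + 2^-1)) => ?;
  [case: (leP (2 * r) (1 * r + 4^-1)) => ?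
  |case: (leP (2 * r) (2^-1 * r + 2^-1)) => ?]; lra.
- by [].
- by rewrite min_l; [lra|rewrite le_min; apply/andP; split; lra].
- rewrite [X in Num.min _ X]min_r; last by lra.
  by rewrite min_r; lra.
- by left; rewrite min_l; [lra|rewrite le_min; apply/andP; split; lra].
- right; rewrite [X in Num.min _ X]min_r; last by lra.
  by rewrite min_r; lra.
- move=> x; have x01 := uvalP (x ord0); set r : R := x ord0 in x01 *.
  rewrite /= /concat_fun -/r; have [r2|r2] := leP r 2^-1.
    rewrite set_first0; last by lra.
    rewrite [X in Num.min _ X]min_l; last by lra.
    have [r4|r4] := leP (2 * r) 2^-1.
      rewrite min_l; last by lra.
      rewrite set_first0; last by lra.
      by rewrite r4 !set_first_set.
    rewrite min_r; last by lra.
    rewrite set_first0; last by lra.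
    have -> : (1 * r + 4^-1 <= 2^-1) = false by apply/negP; lra.
    rewrite set_first0; last by lra.
    have -> : (2 * (1 * r + 4^-1) - 1 <= 2^-1) by lra.
    by rewrite !set_first_set; congr (h (set_first _ _)); lra.
  rewrite [X in Num.min _ X]min_r; last by lra.
  rewrite min_r; last by lra.
  rewrite set_first0; last by lra.
  have -> : (2^-1 * r + 2^-1 <= 2^-1) = false by apply/negP; lra.
  rewrite set_first0; last by lra.
  have -> : (2 * (2^-1 * r + 2^-1) - 1 <= 2^-1) = false by apply/negP; lra.
  by rewrite !set_first_set; congr (l (set_first _ _)); lra.
- by move=> x; rewrite set_first_id.
Qed.

Lemma concat_invr (f : loop) :
  homotopic (loop_concat f (loop_inverse f)) (loop_cst gamma x0 k.+1).
Proof.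
apply: (@homotopic_reparam f _ _
  (fun r => Num.min (2 * r) ((-2) * r + 2)) (fun=> 0)).
- apply: lip2_min; first exact: lip2_2.
  by apply: lip2_affine; rewrite normrN ger0_norm.
- exact: lip2_cst.
- by move=> r r01; case: (leP (2 * r) ((-2) * r + 2)) => ?; lra.
- by move=> r _; rewrite lexx ler01.
- by rewrite min_l; lra.
- by rewrite min_r; lra.
- by left; rewrite min_l; lra.
- by left; rewrite min_r; lra.
- move=> x; have x01 := uvalP (x ord0); set r : R := x ord0 in x01 *.
  rewrite /= /concat_fun -/r; have [r2|r2] := leP r 2^-1.
    by rewrite min_l//; lra.
  rewrite min_r; last by lra.
  rewrite set_first0; last by lra.
  by rewrite set_first_set; congr (f (set_first _ _)); lra.
- by move=> x; rewrite loop_val0//; left.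
Qed.

Lemma concat_invl (f : loop) :
  homotopic (loop_concat (loop_inverse f) f) (loop_cst gamma x0 k.+1).
Proof.
apply: (@homotopic_reparam f _ _
  (fun r => Num.max ((-2) * r + 1) (2 * r - 1)) (fun=> 1)).
- apply: lip2_max; apply: lip2_affine; first by rewrite normrN ger0_norm.
  by rewrite ger0_norm.
- exact: lip2_cst.
- by move=> r r01; case: (leP ((-2) * r + 1) (2 * r - 1)) => ?; lra.
- by move=> r _; rewrite lexx ler01.
- by rewrite max_l; lra.
- by rewrite max_r; lra.
- by right; rewrite max_l; lra.
- by right; rewrite max_r; lra.
- move=> x; have x01 := uvalP (x ord0); set r : R := x ord0 in x01 *.
  rewrite /= /concat_fun -/r; have [r2|r2] := leP r 2^-1.
    rewrite max_l; last by lra.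
    rewrite set_first0; last by lra.
    by rewrite set_first_set; congr (f (set_first _ _)); lra.
  by rewrite max_r//; lra.
- by move=> x; rewrite loop_val0//; right.
Qed.

Definition pi_one : pi := loop_class (loop_cst gamma x0 k.+1).
Definition pi_mul (a b : pi) : pi := loop_class (loop_concat (repr a) (repr b)).
Definition pi_inv (a : pi) : pi := loop_class (loop_inverse (repr a)).

Lemma repr_pi (f : loop) : homotopic (repr (loop_class f)) f.
Proof. by apply/loop_classP; rewrite loop_classK. Qed.

Lemma pi_mulE (f h : loop) :
  pi_mul (loop_class f) (loop_class h) = loop_class (loop_concat f h).
Proof. by apply/loop_classP; apply: homotopic_concat; exact: repr_pi. Qed.

Lemma pi_invE (f : loop) : pi_inv (loop_class f) = loop_class (loop_inverse f).
Proof. by apply/loop_classP; apply: homotopic_inverse; exact: repr_pi. Qed.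

Lemma pi_mulA : associative pi_mul.
Proof.
move=> a b c; rewrite -(loop_classK a) -(loop_classK b) -(loop_classK c) !pi_mulE.
by apply/loop_classP; exact: concatA.
Qed.

Lemma pi_mul1 : left_id pi_one pi_mul.
Proof.
by move=> a; rewrite -(loop_classK a) pi_mulE; apply/loop_classP; exact: concat_idl.
Qed.

Lemma pi_mulr1 : right_id pi_one pi_mul.
Proof.
by move=> a; rewrite -(loop_classK a) pi_mulE; apply/loop_classP; exact: concat_idr.
Qed.

Lemma pi_mulV : left_inverse pi_one pi_inv pi_mul.
Proof.
move=> a; rewrite -(loop_classK a) pi_invE pi_mulE.
by apply/loop_classP; exact: concat_invl.
Qed.

Lemma pi_mulrV : right_inverse pi_one pi_inv pi_mul.
Proof.
move=> a; rewrite -(loop_classK a) pi_invE pi_mulE.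
by apply/loop_classP; exact: concat_invr.
Qed.

HB.instance Definition _ := isGroup.Build pi
  pi_mulA pi_mul1 pi_mulr1 pi_mulV pi_mulrV.

End Group.

(* Main.v *)
Require Import Defs.
From HB Require Import structures.
From mathcomp Require Import all_boot all_order all_algebra.
From mathcomp Require Import interval_inference ring lra.
From mathcomp Require Import all_classical all_reals all_analysis.

Import Order.TTheory GRing.Theory Num.Theory.
Local Open Scope ring_scope.

(** The Heisenberg group is contracted to [p] by the dilations centred at [p].
    Such a dilation of ratio [s] multiplies the Korányi metric by [s], and along
    the orbit of a point at distance at most [M] from [p] it moves by at most
    [2 M |s - s'|^(1/2)]. Composing a bounded [gamma]-Hölder loop with the
    dilations of ratio [1 - t] is therefore a [gamma]-Hölder homotopy as soon as
    [gamma <= 1/2], and it keeps [p] fixed. *)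

Section Dilation.
Variables (R : realType) (n : nat).
Implicit Types (p q r : heis R n) (s : R).

(* [p * delta_s (p^-1 * q)] for the group law of [tdiff] and
   [delta_s (z, t) = (s z, s^2 t)]. *)
Definition dilate p s q : heis R n :=
  (p.1.1 + s *: (q.1.1 - p.1.1), p.1.2 + s *: (q.1.2 - p.1.2),
   ht p + s ^+ 2 * tdiff q p + 2 * s * \sum_j (hx q j * hy p j - hx p j * hy q j)).

Lemma hx_dilate p s q j : hx (dilate p s q) j = hx p j + s * (hx q j - hx p j).
Proof. by rewrite /hx /= !mxE. Qed.

Lemma hy_dilate p s q j : hy (dilate p s q) j = hy p j + s * (hy q j - hy p j).
Proof. by rewrite /hy /= !mxE. Qed.

Lemma ht_dilate p s q : ht (dilate p s q) =
  ht p + s ^+ 2 * tdiff q p + 2 * s * \sum_j (hx q j * hy p j - hx p j * hy q j).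
Proof. by []. Qed.

(** The last summand of [ht_dilate] is what makes the terms linear in [s] and [s'] cancel; the
    symplectic form of the displacements from [p] remains. *)
Lemma tdiff_dilate p s s' q r : tdiff (dilate p s q) (dilate p s' r) =
  s ^+ 2 * tdiff q p - s' ^+ 2 * tdiff r p
  + 2 * (s * s') * \sum_j ((hx r j - hx p j) * (hy q j - hy p j)
                           - (hx q j - hx p j) * (hy r j - hy p j)).
Proof.
rewrite [LHS]/tdiff !ht_dilate.
set A := \sum_j (hx q j * hy p j - _); set B := \sum_j (hx r j * hy p j - _).
set C := \sum_j ((hx r j - _) * _ - _).
suff -> : \sum_j (hx (dilate p s' r) j * hy (dilate p s q) j
    - hx (dilate p s q) j * hy (dilate p s' r) j) = - s * A + s' * B + s * s' * C.
  by ring.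
rewrite /A /B /C !mulr_sumr -!big_split; apply: eq_bigr => j _ /=.
by rewrite !hx_dilate !hy_dilate; ring.
Qed.

(** Both [zdist ^+ 2] and [tdiff] scale by [s ^+ 2], so the fourth power of the metric scales by
    [s ^+ 4]. *)
Lemma koranyi_dilate p s q r : 0 <= s ->
  koranyi (dilate p s q) (dilate p s r) = s * koranyi q r.
Proof.
move=> s0; apply/eqP; rewrite -(@eqrXn2 _ 4) ?mulr_ge0 ?koranyi_ge0//.
have zE : zdist (dilate p s q) (dilate p s r) ^+ 2 = s ^+ 2 * zdist q r ^+ 2.
  rewrite !zdist2 mulr_sumr; apply: eq_bigr => j _.
  by rewrite !hx_dilate !hy_dilate; ring.
have tE : tdiff (dilate p s q) (dilate p s r) = s ^+ 2 * tdiff q r.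
  rewrite tdiff_dilate /tdiff.
  set A := \sum_j _; set B := \sum_j _; set C := \sum_j _; set D := \sum_j _.
  suff -> : D = A - B + C by ring.
  rewrite /A /B /C /D -!sumrN -!big_split; apply: eq_bigr => j _ /=.
  by ring.
by rewrite exprMn !koranyi4 zE tE; apply/eqP; ring.
Qed.

(** On a single orbit the symplectic term vanishes by antisymmetry. The vertical part, with
    [s ^+ 2 - s' ^+ 2 = (s - s') * (s + s')], yields only two powers of [s - s'] out of four: this
    is the source of the exponent 1/2. *)
Lemma koranyi4_dilate_orbit p s s' q :
  koranyi (dilate p s q) (dilate p s' q) ^+ 4 =
  (s - s') ^+ 2 * ((s - s') ^+ 2 * (zdist q p ^+ 2) ^+ 2
                   + (s + s') ^+ 2 * tdiff q p ^+ 2).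
Proof.
have zE : zdist (dilate p s q) (dilate p s' q) ^+ 2
    = (s - s') ^+ 2 * zdist q p ^+ 2.
  rewrite !zdist2 mulr_sumr; apply: eq_bigr => j _.
  by rewrite !hx_dilate !hy_dilate; ring.
rewrite koranyi4 zE tdiff_dilate big1 => [|j _]; last by ring.
by ring.
Qed.

Lemma koranyi_dilate_orbit p s s' q (g : R) : 0 < g -> g <= 1 / 2 ->
  0 <= s <= 1 -> 0 <= s' <= 1 ->
  koranyi (dilate p s q) (dilate p s' q) <= 2 * koranyi q p * `|s - s'| `^ g.
Proof.
move=> g0 g2 s01 s'01.
have [->|ss'] := eqVneq s s'.
  by rewrite koranyixx !mulr_ge0 ?koranyi_ge0 ?powR_ge0.
set d := `|s - s'|.
have d0 : 0 < d by rewrite normr_gt0 subr_eq0.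
have d1 : d <= 1 by rewrite ler_norml; lra.
(* Here [g <= 1 / 2] enters: [d <= 1] and [4 * g <= 2]. *)
have dg : d ^+ 2 <= (d `^ g) ^+ 4.
  rewrite -!powR_mulrn ?powR_ge0 ?(ltW d0)// -powRrM ger_powR ?d0//.
  by lra.
have d2 : (s - s') ^+ 2 = d ^+ 2 by rewrite real_normK ?num_real.
rewrite -(@ler_pXn2r _ 4) ?nnegrE ?mulr_ge0 ?koranyi_ge0 ?powR_ge0//.
rewrite koranyi4_dilate_orbit 2![in leRHS]exprMn koranyi4 d2 mulrC.
set z := (zdist q p ^+ 2) ^+ 2; set t := tdiff q p ^+ 2.
have z0 : 0 <= z by exact: sqr_ge0.
have t0 : 0 <= t by exact: sqr_ge0.
apply: ler_pM => //; first by apply: addr_ge0; apply: mulr_ge0 => //; exact: sqr_ge0.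
  exact: sqr_ge0.
(* The bracket is at most [z + 4 * t], well below [2 ^+ 4 * (z + t)]. *)
have le1 : d ^+ 2 <= 1 by rewrite expr_le1// ltW.
have le4 : (s + s') ^+ 2 <= 4 by nra.
have := ler_wpM2r z0 le1; have := ler_wpM2r t0 le4.
by lra.
Qed.

Lemma dilate1 p q : dilate p 1 q = q.
Proof.
case: q => [[qx qy] qt]; rewrite /dilate /= !scale1r ![_ + (_ - _)]addrC !subrK.
congr (_, _, _); rewrite /tdiff /ht /=.
set A := \sum_j _; set B := \sum_j _.
suff -> : B = - A by ring.
by rewrite -sumrN; apply: eq_bigr => j _; ring.
Qed.

Lemma dilate0 p q : dilate p 0 q = p.
Proof.
case: p => [[px py] pt]; rewrite /dilate /= !scale0r !addr0.
by congr (_, _, _); rewrite /ht /=; ring.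
Qed.

Lemma dilate_center p s : dilate p s p = p.
Proof.
case: p => [[px py] pt]; rewrite /dilate /= !subrr !scaler0 !addr0.
congr (_, _, _); rewrite /tdiff /ht /= big1 => [|j _]; last by ring.
by ring.
Qed.

End Dilation.

Arguments dilate {R n}.

Lemma mdist_set_first0 (R : realType) (k : nat) (x : cube R k.+1) :
  mdist x (set_first 0 x) <= 1.
Proof.
rewrite mdist_cubeE sqrt_le_sqr ?ler01// (bigD1 ord0)//= big1 => [|i i0].
  have := uvalP (x ord0).
  by rewrite set_first0 ?lexx ?ler01//; nra.
by rewrite ffunE (negbTE i0) subrr expr0n.
Qed.

(** Every point of the cube is within distance 1 of the face where the first coordinate is 0, on
    which the loop equals [x0]; the Hölder constant is thus itself a bound. *)
Lemma loop_bounded (R : realType) (gamma : {posnum R}) (X : metricType R)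
    (x0 : X) (k : nat) (f : holder_loop gamma x0 k.+1) :
  exists2 M : R, 0 <= M & forall x, mdist (f x) x0 <= M.
Proof.
have /holderP[C C0 fC] := loop_holder f; exists C => // x.
have := fC x (set_first 0 x); rewrite (loop_val0 f x (or_introl (lexx 0))).
move=> /le_trans; apply; rewrite -[leRHS]mulr1 ler_wpM2l//.
apply: le_trans (le_powRg gamma (mdist_ge0 _ _) (mdist_set_first0 R k x)) _.
by rewrite powR1.
Qed.

Lemma heis_loop_null (R : realType) (n k : nat) (gamma : {posnum R})
    (p : heis R n) (f : holder_loop gamma p k.+1) :
  gamma%:num <= 1 / 2 -> homotopic f (loop_cst gamma p k.+1).
Proof.
move=> g2; have [M M0 fM] := loop_bounded _ _ _ _ _ f.
have /holderP[C C0 fC] := loop_holder f.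
exists (fun u : l2prod (unit_itv R) (cube R k.+1) =>
  dilate p (1 - (u.1 : R)) (f u.2)); split.
- apply/holderP; exists (C + 2 * M); first by rewrite addr_ge0 ?mulr_ge0.
  move=> u v; have u01 := uvalP u.1; have v01 := uvalP v.1.
  (* Move first in the cube at fixed time, where the dilation has ratio at most 1 and costs [C],
     then in time along one orbit, which costs [2 * M]. *)
  apply: le_trans (metric_triangle _ (dilate p (1 - (u.1 : R)) (f v.2)) _) _.
  rewrite mulrDl lerD//.
    apply: (@le_trans _ _ (mdist (f u.2) (f v.2))).
      rewrite [leLHS]koranyi_dilate; last by lra.
      by rewrite ler_piMl ?koranyi_ge0//; lra.
    apply: le_trans (fC _ _) _; rewrite ler_wpM2l// le_powRg ?mdist_ge0//.
    exact: l2dist_snd.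
  apply: le_trans (@koranyi_dilate_orbit _ _ _ _ _ _ gamma%:num _ g2 _ _) _ => //.
  + by lra.
  + by lra.
  apply: ler_pM; rewrite ?mulr_ge0 ?koranyi_ge0 ?powR_ge0//.
    by rewrite ler_wpM2l//; exact: fM.
  rewrite le_powRg//.
  have -> : 1 - (u.1 : R) - (1 - (v.1 : R)) = (v.1 : R) - (u.1 : R) by ring.
  by rewrite distrC; exact: (l2dist_fst u v).
- by move=> x; rewrite /= maxminE ?lexx ?ler01// subr0 dilate1.
- by move=> x; rewrite /= maxminE ?lexx ?ler01// subrr dilate0.
(* The neighborhood for [f] serves at every time, since dilations fix [p]. *)
- move=> t; have [U [oU bU fU]] := loop_base f; exists U; split=> // x Ux.
  by rewrite fU// dilate_center.
Qed.

(** The successors encode [k, n >= 1]; each class is that of a loop, and the loop is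
    null-homotopic. *)
Theorem proposition10p2 (R : realType) (k n : nat) (gamma : R)
    (gamma_gt0 : 0 < gamma) (gamma_le : gamma <= 1 / 2) (p : heis R n.+1)
    (a : holder_pi (PosNum gamma_gt0) p k.+1) :
  a = 1%g.
Proof.
by rewrite -(loop_classK a); apply/loop_classP; exact: heis_loop_null.
Qed.
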